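(* If $(\mathcal K,\mathcal K')$ is a shifted family pair, then $$\mathbf s(\mathcal K,\mathcal K')\circeq \mathbf d(\mathcal K,\mathcal K')^T .$$ That is, the multiset of non-zero eigenvalues (with multiplicity) of the Laplacian $L(\mathcal K,\mathcal K')$ equals the multiset of non-zero parts of the conjugate of the degree sequence $\mathbf d(\mathcal K,\mathcal K')$.
   Context: A $k$-family on a finite ground set $E$ of integers is a collection of $k$-subsets of $E$. For a $k$-family $\mathcal K$, the unsigned boundary $\operatorname{bd}\mathcal K$ is the $(k-1)$-family of all $(k-1)$-subsets of members of $\mathcal K$. A family pair $(\mathcal K,\mathcal K')$ consists of a $k$-family $\mathcal K$ and a $(k-1)$-family $\mathcal K'$ on the same ground set (for some $k\ge 1$), where $(\mathcal K,\mathcal K')$ and $(\mathcal K,\mathcal K'')$ are identified whenever $(\operatorname{bd}\mathcal K)\cap\mathcal K'=(\operatorname{bd}\mathcal K)\cap\mathcal K''$. For $k$-subsets $F=\{f_1<\cdots<f_k\}$, $G=\{g_1<\cdots<g_k\}$ of $E$ write $F\le_P G$ if $f_p\le g_p$ for all $p$; a $k$-family $\mathcal K$ is shifted if $F\le_P G$ and $G\in\mathcal K$ imply $F\in\mathcal K$. The pair $(\mathcal K,\mathcal K')$ is a shifted family pair if $\mathcal K$ is shifted and $(\mathcal K,\mathcal K')=(\mathcal K,\mathcal K'')$ for some $\mathcal K''$ that is shifted on the same ordered ground set. $C(\mathcal K;\mathbb R)$ is the real vector space of formal linear combinations of oriented faces $[F]$, $F\in\mathcal K$. The boundary operator $\partial_{(\mathcal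 K,\mathcal K')}\colon C(\mathcal K;\mathbb R)\to C((\operatorname{bd}\mathcal K)\setminus\mathcal K';\mathbb R)$ is the usual signed simplicial boundary with the sum restricted to faces in $(\operatorname{bd}\mathcal K)\setminus\mathcal K'$; $\partial^*_{(\mathcal K,\mathcal K')}$ is its adjoint (transposed matrix in the natural bases). The Laplacian is $L(\mathcal K,\mathcal K')=\partial^*_{(\mathcal K,\mathcal K')}\partial_{(\mathcal K,\mathcal K')}$, and $\mathbf s(\mathcal K,\mathcal K')$ is its multiset of eigenvalues in weakly decreasing order. For $\lambda\in E$, the degree is $d_\lambda(\mathcal K,\mathcal K')=|\{F\in\mathcal K:\lambda\in F,\ F\setminus\{\lambda\}\notin\mathcal K'\}|$, and the degree sequence $\mathbf d(\mathcal K,\mathcal K')$ is the partition whose parts are the numbers $d_\lambda(\mathcal K,\mathcal K')$, $\lambda\in E$. $\boldsymbol\lambda^T$ denotes the conjugate (transpose) of a partition $\boldsymbol\lambda$, and $\circeq$ means that two multisets agree in the multiplicities of all non-zero elements. *)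

(* Defs.v *)
From HB Require Import structures.
From mathcomp Require Import all_boot all_order all_algebra.
From mathcomp Require Import finmap reals.

Set Implicit Arguments.
Unset Strict Implicit.
Unset Printing Implicit Defensive.

Import Order.TTheory GRing.Theory Num.Theory.
Local Open Scope ring_scope.

Section Families.

Variable E : {fset int}.
Implicit Types (F G : {set E}) (K : {set {set E}}).

Definition is_family (k : nat) K : Prop :=
  forall F, F \in K -> #|F| = k.

Definition bd K : {set {set E}} :=
  [set F :\ v | F in K, v in F].

Definition same_pair K K' K'' : Prop := bd K :&: K' = bd K :&: K''.

(* The increasing sequence f_1 < ... < f_k of the elements of a face. *)
Definition elems F : seq int := sort <=%R [seq val x | x in F].

Definition le_P F G : Prop :=
  #|F| = #|G| /\
  forall p : nat, (p < #|F|)%N -> (elems F)`_p <= (elems G)`_p.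

Definition shifted (k : nat) K : Prop :=
  forall F G, #|F| = k -> #|G| = k -> le_P F G -> G \in K -> F \in K.

Definition shifted_pair (k : nat) K K' : Prop :=
  shifted k K /\
  exists K'', [/\ is_family k.-1 K'', same_pair K K' K'' & shifted k.-1 K''].

(* Chains are column vectors in the natural bases: columns are indexed by the
   faces F of K, rows by the faces of (bd K) \ K'.  The face F minus v occurs
   in the boundary of [F] with sign (-1) ^ (p - 1), where v is the p-th
   smallest element of F.                                                   *)
Definition boundary_mx (R : realType) K K' :
    'M[R]_(#|bd K :\: K'|, #|K|) :=
  \matrix_(i, j)
    let F : {set E} := enum_val j in let G : {set E} := enum_val i in
    \sum_(v in F | F :\ v == G)
      (-1) ^+ #|[set u in F | val u < val v]|.

Definition laplacian (R : realType) K K' : 'M[R]_#|K| :=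
  (boundary_mx R K K')^T *m boundary_mx R K K'.

Definition degree K K' (x : E) : nat :=
  #|[set F in K | (x \in F) && (F :\ x \notin K')]|.

Definition degree_seq K K' : seq nat :=
  sort geq [seq degree K K' x | x : E].

End Families.

(* The j-th part (j >= 1) of the conjugate partition is the number of parts
   that are at least j.                                                     *)
Definition conj_part (s : seq nat) : seq nat :=
  [seq count (leq j) s | j <- iota 1 (\max_(i <- s) i)].

(* s lists the eigenvalues of A with algebraic multiplicity, in weakly
   decreasing order.  At most one such s exists over a given field, and one
   exists exactly when the characteristic polynomial of A splits.           *)
Definition is_spectrum (R : realType) (n : nat) (A : 'M[R]_n) (s : seq R) :
    Prop :=
  sorted >=%R s /\ char_poly A = \prod_(a <- s) ('X - a%:P).

Definition eq_nonzero (R : realType) (s t : seq R) : Prop :=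
  forall x : R, x != 0 -> count_mem x s = count_mem x t.

(* Main.v *)
Require Import Defs.
From mathcomp Require Import all_boot all_order all_algebra.
From mathcomp Require Import finmap reals.
From mathcomp Require Import zify ring.

Set Implicit Arguments.
Unset Strict Implicit.
Unset Printing Implicit Defensive.

Import Order.TTheory GRing.Theory Num.Theory.
Local Open Scope ring_scope.

(* Let t be the smallest vertex, D1 and D2 the boundary matrices of the deletion
   and the link of t, and m the degree of t.  Writing a chain as a + t b, the
   boundary is [D1, I; 0, -D2] up to zero columns, where D2 D1 = 0 because the
   pair is shifted.  Hence the Laplacian has the nonzero eigenvalues of
   I + D1 D1^T + D2^T D2 on an m-dimensional space, and since the last two
   summands annihilate each other, these are the eigenvalues of the deletion and
   of the link, padded with zeros to m parts and increased by 1.  Degree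
   sequences obey the same recursion: the degrees are weakly decreasing along the
   vertex order, so conjugation turns the sum of the degree sequences of deletion
   and link into a union, and the extra part m adds 1 to the first m parts of the
   conjugate.  The recursion is carried out on characteristic polynomials. *)

(** * Generating polynomial of a conjugate partition *)

(* For d weakly decreasing this is the product of ('X - t)^(d_t - d_(t+1)), hence
   multiplicative in d. *)
Fixpoint conj_poly (R : comNzRingType) (d : seq nat) : {poly R} :=
  if d is m :: d' then
    ('X - 1) ^+ (m - head 0%N d') * (conj_poly R d' \Po ('X - 1))
  else 1.

Lemma sorted_geq_cons m (d : seq nat) :
  sorted geq (m :: d) = (head 0%N d <= m)%N && sorted geq d.
Proof. by case: d. Qed.

(** Both sequences must decrease so that the truncated differences [m - head 0 d'] add up;
    composition with ['X - 1] is multiplicative. *)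
Lemma conj_poly_add (R : comNzRingType) (T : Type) (f g : T -> nat) s :
  sorted geq (map f s) -> sorted geq (map g s) ->
  conj_poly R [seq (f x + g x)%N | x <- s] =
    conj_poly R (map f s) * conj_poly R (map g s).
Proof.
elim: s => [|x s IH]; first by rewrite mulr1.
rewrite !map_cons !sorted_geq_cons => /andP[fx /IH{}IH] /andP[gx /IH{}IH] /=.
rewrite {}IH comp_polyM mulrACA -exprD; congr (_ ^+ _ * _).
by case: s fx gx => //= y s; lia.
Qed.

(** The exponents telescope to the largest part. This later recovers the exponents of ['X] that the
    induction leaves unspecified. *)
Lemma size_conj_poly (R : idomainType) d :
  sorted geq d -> size (conj_poly R d) = (head 0%N d).+1.
Proof.
elim: d => [|m d IH]; first by rewrite size_poly1.
rewrite sorted_geq_cons => /andP[dm /IH{}IH] /=.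
have sX : size ('X - 1 : {poly R}) = 2 by rewrite size_XsubC.
have s1 : size (conj_poly R d \Po ('X - 1)) = (head 0%N d).+1.
  by rewrite size_comp_poly2.
rewrite size_mul ?expf_neq0 -?size_poly_gt0 ?s1 ?sX //.
by rewrite size_exp_XsubC; lia.
Qed.

Lemma bigmax_sorted_geq d : sorted geq d -> (\max_(i <- d) i)%N = head 0%N d.
Proof.
elim: d => [|m d IH]; first by rewrite big_nil.
by rewrite sorted_geq_cons big_cons => /andP[dm /IH ->]; apply/maxn_idPl.
Qed.

Lemma prod_conj_part (R : comNzRingType) d :
  sorted geq d -> \prod_(m <- conj_part d) ('X - m%:R%:P) = conj_poly R d.
Proof.
rewrite /conj_part => sd; rewrite bigmax_sorted_geq // big_map.
elim: d sd => [|m d IH]; first by rewrite big_nil.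
rewrite sorted_geq_cons => /andP[dm sd] /=.
(* Indices above [head 0 d] see only the part [m] and give conjugate part 1; at every smaller index
   [m] raises the conjugate part by 1. *)
rewrite -{IH}(IH sd) -[m in iota 1 m](subnKC dm) iotaD big_cat [LHS]mulrC.
congr (_ * _).
  rewrite big_seq (eq_bigr (fun=> 'X - 1)) => [|j].
    by rewrite -big_seq big_const_seq count_predT size_iota iter_mulr_1.
  rewrite mem_iota => jdm.
  have [jd jm] : (head 0 d < j)%N /\ (j <= m)%N by lia.
  rewrite jm (_ : count _ d = 0%N) //; apply/eqP; rewrite -leqn0 leqNgt.
  rewrite -has_count -all_predC; apply/allP => x xd /=; rewrite -ltnNge.
  rewrite (leq_ltn_trans _ jd) // -(bigmax_sorted_geq sd).
  exact: (leq_bigmax_seq _ xd).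
rewrite -[RHS]/(comp_poly _ _) rmorph_prod big_seq [RHS]big_seq.
apply: eq_bigr => j; rewrite mem_iota => /andP[j1 jd].
have -> : (j <= m)%N by lia.
by rewrite /= comp_polyB comp_polyX comp_polyC natrD polyCD opprD addrA.
Qed.

(** * Determinant and characteristic polynomial identities *)

(** Both sides compute the determinant of [[a, A; B, 1]], up to a power of [a], after clearing its
    lower left block from the right or from the left. No division by [a] occurs. *)
Lemma det_scalar_sub_mulmxC (R : comNzRingType) m n (a : R)
    (A : 'M[R]_(m, n)) (B : 'M[R]_(n, m)) :
  a ^+ n * \det (a%:M - A *m B) = a ^+ m * \det (a%:M - B *m A).
Proof.
have e1 : \det (block_mx a%:M A B 1%:M) = \det (a%:M - A *m B).
  have d1 : \det (block_mx (1%:M : 'M[R]_m) 0 (- B) 1%:M) = 1.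
    by rewrite det_lblock !det1 mulr1.
  transitivity (\det (block_mx a%:M A B 1%:M *m block_mx 1%:M 0 (- B) 1%:M)).
    by rewrite det_mulmx d1 mulr1.
  rewrite mulmx_block !mulmx1 !mulmx0 !add0r.
  by rewrite mul1mx subrr mulmxN det_ublock det1 mulr1.
rewrite -e1 -[a ^+ n](_ : \det (block_mx 1%:M 0 (- B) (a%:M : 'M_n)) = _).
  rewrite -det_mulmx mulmx_block !mul1mx !mul0mx !addr0 mulmx1.
  rewrite mulNmx -scalar_mxC addNr det_ublock det_scalar.
  by rewrite mulNmx addrC.
by rewrite det_lblock det1 det_scalar mul1r.
Qed.

Lemma char_poly_mulmxC (R : comNzRingType) m n (A : 'M[R]_(m, n))
    (B : 'M[R]_(n, m)) :
  'X^n * char_poly (A *m B) = 'X^m * char_poly (B *m A).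
Proof.
by rewrite /char_poly /char_poly_mx !map_mxM det_scalar_sub_mulmxC.
Qed.

(** Conjugation by the unipotent [[1, 0; D, 1]] makes the matrix block upper triangular;
    [W *m D = D] is what kills the lower left block. *)
Lemma det_block_gram (R : comNzRingType) n (a : R) (C D W : 'M[R]_n) :
  W *m D = D ->
  \det (a%:M - block_mx (C *m D) C D W) = a ^+ n * \det (a%:M - (W + D *m C)).
Proof.
move=> WD; rewrite scalar_mx_block opp_block_mx add_block_mx !add0r.
set L := block_mx _ _ _ _.
have <- : \det (block_mx 1%:M 0 D 1%:M) * \det L *
          \det (block_mx 1%:M 0 (- D) 1%:M) = \det L.
  by rewrite !det_lblock !det1 !mul1r mulr1.
rewrite -mulrA -!det_mulmx !mulmx_block !mulmx1 !mulmx0 !mul0mx !mul1mx.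
rewrite !addr0 !add0r !mulmxN !mulNmx opprK subrK mulmxBl WD.
rewrite scalar_mxC opprB addKr subrr.
by rewrite det_ublock det_scalar [- (D *m C) + _]addrC opprD addrA.
Qed.

Lemma char_poly_block_gram (R : comNzRingType) n (C D W : 'M[R]_n) :
  W *m D = D ->
  char_poly (block_mx (C *m D) C D W) = 'X^n * char_poly (W + D *m C).
Proof.
move=> WD; rewrite /char_poly /char_poly_mx map_block_mx map_mxD !map_mxM.
by rewrite det_block_gram // -map_mxM WD.
Qed.

Lemma char_poly_shift (R : comNzRingType) n (A : 'M[R]_n) (q : {poly R}) :
  char_poly A \Po q = \det (q%:M - map_mx polyC A).
Proof.
rewrite /char_poly -[LHS]/(comp_poly q _) -det_map_mx; congr (\det _).
apply/matrixP => i j; rewrite !mxE /= comp_polyB comp_polyC.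
by case: eqP; rewrite ?mulr1n ?comp_polyX // !mulr0n comp_poly0.
Qed.

(* (X - P)(X - 1 - A) = (X - 1)(X - P - A) when P A = A. *)
Lemma char_poly_addl (R : comNzRingType) n (P A : 'M[R]_n) :
  P *m A = A ->
  ('X - 1) ^+ n * char_poly (P + A) = char_poly P * (char_poly A \Po ('X - 1)).
Proof.
move=> PA; rewrite char_poly_shift -det_scalar /char_poly -!det_mulmx.
congr (\det _); rewrite /char_poly_mx map_mxD.
have := congr1 (map_mx polyC) PA; rewrite map_mxM.
move: (map_mx _ P) (map_mx _ A) => p a pa.
have -> : ('X - 1)%:M = 'X%:M - 1%:M :> 'M[{poly R}]_n by rewrite raddfB.
rewrite [RHS]mulmxBl [in RHS]mulmxBr !mulmxBl !mulmxBr mulmxDr.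
rewrite !mul1mx pa !mulmx1 (scalar_mxC _ p).
move: ('X%:M *m p) ('X%:M *m a) ('X%:M *m 'X%:M) => u v w.
by apply/matrixP => i j; rewrite !mxE; ring.
Qed.

(** (X - P)(X - Q) = X (X - P - Q) when P Q = 0. *)
Lemma char_poly_add (R : comNzRingType) n (P Q : 'M[R]_n) :
  P *m Q = 0 -> 
  'X^n * char_poly (P + Q) = char_poly P * char_poly Q.
Proof.
move=> PQ; rewrite -det_scalar /char_poly -!det_mulmx; congr (\det _).
rewrite /char_poly_mx map_mxD.
have := congr1 (map_mx polyC) PQ; rewrite map_mxM map_mx0.
move: (map_mx _ P) (map_mx _ Q) => p a pa.
by rewrite mulmxBr [RHS]mulmxBl !mulmxBr pa subr0 mulmxDr scalar_mxC opprD addrA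
  addrAC (scalar_mxC _ p).
Qed.

(** * Matrices indexed by finite types *)

Section FunctionMatrices.
Variable R : comNzRingType.

Definition fun_mx (I J : finType) (f : I -> J -> R) : 'M[R]_(#|I|, #|J|) :=
  \matrix_(i, j) f (enum_val i) (enum_val j).

Lemma eq_fun_mx (I J : finType) (f g : I -> J -> R) :
  (forall x y, f x y = g x y) -> fun_mx f = fun_mx g.
Proof. by move=> fg; apply/matrixP => i j; rewrite !mxE. Qed.

Lemma mul_fun_mx (I J L : finType) (f : I -> J -> R) (g : J -> L -> R) :
  fun_mx f *m fun_mx g = fun_mx (fun x z => \sum_y f x y * g y z).
Proof.
apply/matrixP => i j; rewrite !mxE [RHS]big_enum_val.
by apply: eq_bigr => l _; rewrite !mxE.
Qed.

Lemma tr_fun_mx (I J : finType) (f : I -> J -> R) :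
  (fun_mx f)^T = fun_mx (fun y x => f x y).
Proof. by apply/matrixP => i j; rewrite !mxE. Qed.

Lemma add_fun_mx (I J : finType) (f g : I -> J -> R) :
  fun_mx f + fun_mx g = fun_mx (fun x y => f x y + g x y).
Proof. by apply/matrixP => i j; rewrite !mxE. Qed.

Lemma opp_fun_mx (I J : finType) (f : I -> J -> R) :
  - fun_mx f = fun_mx (fun x y => - f x y).
Proof. by apply/matrixP => i j; rewrite !mxE. Qed.

Lemma fun_mx0 (I J : finType) : fun_mx (fun (_ : I) (_ : J) => 0) = 0.
Proof. by apply/matrixP => i j; rewrite !mxE. Qed.

Lemma fun_mx1 (I : finType) : fun_mx (fun x y : I => (x == y)%:R) = 1%:M.
Proof. by apply/matrixP => i j; rewrite !mxE (inj_eq enum_val_inj). Qed.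

(** The diagonal projection onto the coordinates satisfying [A]. *)
Definition pred_mx (I : finType) (A : pred I) : 'M[R]_#|I| :=
  fun_mx (fun x y => ((x == y) && A x)%:R).

Lemma mul_pred_mx (I J : finType) (A : pred I) (f : I -> J -> R) :
  pred_mx A *m fun_mx f = fun_mx (fun x y => (A x)%:R * f x y).
Proof.
rewrite mul_fun_mx; apply: eq_fun_mx => x y.
rewrite (bigD1 x) //= eqxx big1 ?addr0 // => z /negPf zx.
by rewrite eq_sym zx mul0r.
Qed.

Lemma tr_pred_mx (I : finType) (A : pred I) : (pred_mx A)^T = pred_mx A.
Proof.
rewrite tr_fun_mx; apply: eq_fun_mx => x y; rewrite eq_sym.
by case: eqP => // ->.
Qed.

Lemma char_poly_pred_mx (I : finType) (A : pred I) :
  char_poly (pred_mx A) = 'X^(#|I| - #|A|) * ('X - 1) ^+ #|A|.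
Proof.
rewrite char_poly_trig; last first.
  apply/is_trig_mxP => i j ij; rewrite mxE (inj_eq enum_val_inj).
  by rewrite -val_eqE /= ltn_eqF.
transitivity (\prod_(x : I) ('X - ((A x)%:R)%:P) : {poly R}).
  by rewrite [RHS]big_enum_val; apply: eq_bigr => i _; rewrite mxE eqxx.
rewrite (bigID A) /= mulrC -(cardC A) addKn; congr (_ * _).
  rewrite -prodr_const; apply: eq_big => [x|x /negPf ->]; last by rewrite subr0.
  by rewrite !inE.
by rewrite -prodr_const; apply: eq_bigr => x ->.
Qed.

End FunctionMatrices.

(** * Incidence signs of the simplicial boundary *)

Lemma sum_antisym (R : numDomainType) (I : finType) (g : I -> I -> R) :
  (forall i j, g i j = - g j i) -> \sum_i \sum_j g i j = 0.
Proof.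
move=> gN; set S := LHS; have /eqP : S = - S; last first.
  by rewrite -subr_eq0 opprK -mulr2n mulrn_eq0 => /eqP.
rewrite {1}/S exchange_big -sumrN; apply: eq_bigr => i _; rewrite -sumrN.
by apply: eq_bigr => j _.
Qed.

Section Sign.
Variables (R : numDomainType) (E : {fset int}).
Implicit Types (F G H : {set E}) (t u v w : E).

Definition sgn_elt F v : R := (-1) ^+ #|[set u in F | val u < val v]|.

(** At most one [v] contributes, so this is an incidence number; the sum has the shape of the
    entries of [boundary_mx]. *)
Definition sgn_face F G : R := \sum_(v in F | F :\ v == G) sgn_elt F v.

Lemma sgn_face_eq0 F G :
  (forall v, v \in F -> F :\ v <> G) -> sgn_face F G = 0.
Proof.
move=> FG; rewrite /sgn_face big_pred0 // => v; apply/negP => /andP[vF /eqP].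
exact: FG.
Qed.

Lemma sgn_face_neq0 F G :
  sgn_face F G != 0 -> exists2 v, v \in F & G = F :\ v.
Proof.
move=> FG; case: (pickP [pred v in F | F :\ v == G]) => [v /andP[vF /eqP]|no].
  by exists v.
by rewrite /sgn_face big_pred0 ?eqxx // in FG.
Qed.

Lemma sum_sgn_face F (f : {set E} -> R) :
  \sum_G sgn_face F G * f G = \sum_(v in F) sgn_elt F v * f (F :\ v).
Proof.
under eq_bigr do rewrite mulr_suml.
rewrite (exchange_big_dep (mem F)) /= => [|G v _ /andP[] //].
apply: eq_bigr => v vF; rewrite (big_pred1 (F :\ v)) // => G.
by rewrite /= vF eq_sym.
Qed.

(** Removing the smaller vertex moves the larger one down by one position, while removing the larger
    leaves the position of the smaller unchanged. *)
Lemma sgn_elt_swap F v w : v \in F -> w \in F -> v != w ->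
  sgn_elt F v * sgn_elt (F :\ v) w = - (sgn_elt F w * sgn_elt (F :\ w) v).
Proof.
wlog vw : v w / val v < val w => [th|] vF wF nvw.
  have [vw|wv|/val_inj e] := ltgtP (val v) (val w); first exact: th.
    by rewrite (th w v) ?opprK // eq_sym.
  by rewrite e eqxx in nvw.
have -> : sgn_elt (F :\ w) v = sgn_elt F v.
  congr (_ ^+ _); apply: eq_card => u; rewrite !inE.
  by case: eqP => // ->; rewrite (lt_gtF vw) !andbF.
have -> : sgn_elt F w = - sgn_elt (F :\ v) w.
  rewrite /sgn_elt (cardsD1 v) !inE vF vw exprS mulN1r; congr (- (_ ^+ _)).
  by apply: eq_card => u; rewrite !inE andbA.
by rewrite mulNr opprK mulrC.
Qed.

Lemma sgn_face_sgn_face F H : \sum_G sgn_face F G * sgn_face G H = 0.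
Proof.
rewrite sum_sgn_face /sgn_face.
(* Extension by zero to all ordered pairs of vertices, so that antisymmetry applies to a full double
   sum. *)
pose g v w := if [&& v \in F, w \in F, v != w & F :\ v :\ w == H] then
  sgn_elt F v * sgn_elt (F :\ v) w else 0.
rewrite -[RHS](@sum_antisym R _ g) => [|v w].
  rewrite big_mkcond; apply: eq_bigr => v _; rewrite /g mulr_sumr.
  case: ifP => vF; last by rewrite big1.
  rewrite big_mkcond; apply: eq_bigr => w _.
  by rewrite !inE [w == v]eq_sym -andbA andbCA.
rewrite /g ![v == w]eq_sym !setDDl [[set v] :|: _]setUC.
case: and4P => [[vF wF nwv e]|ne].
  by rewrite vF wF nwv e /= sgn_elt_swap // eq_sym.
by case: and4P => [[? ? ? ?]|]; [case: ne | rewrite oppr0].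
Qed.

(** The cone formula d(tF) = F - t dF: the apex comes first, so it has sign +1 and shifts every
    other position by one. *)
Lemma sgn_face_setU1 t F G : (forall u, u \in F -> val t < val u) ->
  sgn_face (t |: F) G = (G == F)%:R - (t \in G)%:R * sgn_face F (G :\ t).
Proof.
move=> tF; have ntF : t \notin F by apply/negP => /tF; rewrite ltxx.
rewrite /sgn_face big_mkcondr big_setU1 //= setU1K //.
congr (_ + _).
  rewrite eq_sym; case: eqP => // _; rewrite /sgn_elt.
  rewrite (_ : [set _ in _ | _] = set0) ?cards0 //.
  apply/setP => u; rewrite !inE; case: eqP => [->|_] /=; first by rewrite ltxx.
  case: (boolP (u \in F)) => //= /tF; rewrite ltNge le_eqVlt negb_or.
  by case/andP => _ /negPf.
rewrite -mulrN -sumrN mulr_sumr [RHS]big_mkcondr; apply: eq_bigr => v vF.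
have vt : v != t by apply: contraNneq ntF => <-.
have -> : (t |: F) :\ v = t |: F :\ v.
  apply/setP => u; rewrite !inE; case: (eqVneq u t) => [->|] //=.
  by rewrite eq_sym vt.
have -> : sgn_elt (t |: F) v = - sgn_elt F v.
  rewrite /sgn_elt (cardsD1 t) !inE eqxx (tF _ vF) exprS mulN1r.
  congr (- (_ ^+ _)); apply: eq_card => u; rewrite !inE.
  by case: eqP => [->|//]; rewrite (negPf ntF).
have [tG|tG] := boolP (t \in G); last first.
  by rewrite mul0r if_same; case: eqP => // e; rewrite -e !inE eqxx in tG.
rewrite mul1r; congr (if _ then _ else _).
apply/eqP/eqP => [<-|->]; last by rewrite setD1K.
by rewrite setU1K // !inE (negPf ntF) andbF.
Qed.

End Sign.

(** * Deletion, link and degrees *)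

Section DeletionLink.
Variable E : {fset int}.
Implicit Types (F G H : {set E}) (K Q : {set {set E}}) (t x y : E).
Implicit Types (e : seq E).

Definition del t K : {set {set E}} := [set F : {set E} in K | t \notin F].

Definition link t K : {set {set E}} :=
  [set F : {set E} | (t \notin F) && (t |: F \in K)].

(** The vertex type stays [E] throughout the recursion; the list [e] records the vertices not yet
    removed. *)
Definition ground e K := forall F, F \in K -> {subset F <= e}.

(* The consequence of shiftedness relative to the ground set [e] that survives
   deletion and link. *)
Definition exchange_closed e K := forall F x y,
  F \in K -> x \in e -> y \in F -> x \notin F -> val x < val y ->
  x |: F :\ y \in K.

Lemma ground_del t e K : ground (t :: e) K -> ground e (del t K).
Proof.
move=> gK F; rewrite inE => /andP[FK tF] x xF; have := gK F FK x xF.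
by rewrite inE => /predU1P[xt|//]; rewrite -xt xF in tF.
Qed.

Lemma ground_link t e K : ground (t :: e) K -> ground e (link t K).
Proof.
move=> gK F; rewrite inE => /andP[tF FK] x xF.
have : x \in t :: e by apply: (gK _ FK); rewrite !inE xF orbT.
by rewrite inE => /predU1P[xt|//]; rewrite -xt xF in tF.
Qed.

Lemma exchange_closed_del t e K :
  t \notin e -> exchange_closed (t :: e) K -> exchange_closed e (del t K).
Proof.
move=> te cK F x y; rewrite !inE => /andP[FK tF] xe yF xF xy.
rewrite cK ?inE ?xe ?orbT //= negb_or (negPf tF) andbF andbT.
by apply: contraNneq te => ->.
Qed.

Lemma exchange_closed_link t e K :
  t \notin e -> exchange_closed (t :: e) K -> exchange_closed e (link t K).
Proof.
move=> te cK F x y; rewrite !inE => /andP[tF FK] xe yF xF xy.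
have tx : t != x by apply: contraNneq te => ->.
have ty : t != y by apply: contraNneq tF => ->.
rewrite (negPf tx) (negPf tF) andbF /=.
have -> : t |: (x |: F :\ y) = x |: (t |: F) :\ y.
  apply/setP => u; rewrite !inE; case: (eqVneq u t) => [->|] //=.
  by rewrite ty orbT.
by apply: cK; rewrite ?inE ?xe ?yF ?orbT // negb_or eq_sym tx.
Qed.

(** The counted faces split according to whether they contain [t]; those that do correspond to faces
    of the link by adding [t]. *)
Lemma degree_neq t K Q x : x != t ->
  degree K Q x =
    (degree (del t K) (del t Q) x + degree (link t K) (link t Q) x)%N.
Proof.
move=> xt; rewrite /degree -(cardsID [set F : {set E} | t \notin F]).
congr (_ + _)%N.
  apply: eq_card => F; rewrite !inE.
  by case: (t \in F); rewrite ?andbF ?andbT.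
rewrite -[RHS](card_in_imset (f := fun F => t |: F)) => [|F G]; last first.
  rewrite !inE -!andbA => /andP[tF _] /andP[tG _] FG.
  by rewrite -(setU1K tF) FG setU1K.
have swap F : x \in F -> t \notin F -> (t |: F) :\ x = t |: F :\ x.
  move=> xF tF; apply/setP => u; rewrite !inE.
  by case: (eqVneq u t) => [->|] //=; rewrite eq_sym xt.
apply: eq_card => G; rewrite !inE negbK; apply/idP/imsetP.
  case/and4P=> tG GK xG GQ; exists (G :\ t); last by rewrite setD1K.
  have tGt : t \notin G :\ t by rewrite !inE eqxx.
  rewrite !inE eqxx setD1K // GK xt xG /= andbF /= -swap ?setD1K //.
  by rewrite !inE xt.
case=> F; rewrite !inE -!andbA => /and4P[tF FK xF FQ] ->.
rewrite !inE eqxx FK xF orbT /= swap //.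
by rewrite (negPf tF) andbF in FQ.
Qed.

(** Identifies the degree of [t] with the rank of the identity block in the boundary matrix. *)
Lemma degree_link t K Q :
  degree K Q t =
    #|[pred F : {set E} | [&& t \notin F, t |: F \in K & F \notin Q]]|.
Proof.
rewrite -(card_in_imset (f := fun F => t |: F)) => [|F G]; last first.
  rewrite !inE => /andP[tF _] /andP[tG _] FG.
  by rewrite -(setU1K tF) FG setU1K.
apply: eq_card => G; rewrite !inE; apply/idP/imsetP.
  case/and3P=> GK tG GQ; exists (G :\ t); last by rewrite setD1K.
  by rewrite !inE eqxx setD1K // GK.
case=> F; rewrite !inE => /and3P[tF FK FQ] ->.
by rewrite FK setU11 setU1K.
Qed.

(* If F contains both x and y with x < y, then F :\ x in Q implies F :\ y in Q,
   so F itself is counted for x; otherwise exchange y for x. *)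
Lemma degree_decr e K Q x y :
  exchange_closed e K -> exchange_closed e Q ->
  x \in e -> val x < val y -> (degree K Q y <= degree K Q x)%N.
Proof.
move=> cK cQ xe xy.
have nxy : x != y by apply: contraTneq xy => ->; rewrite ltxx.
pose f F := if x \in F then F else x |: F :\ y.
rewrite /degree -(card_in_imset (f := f)) => [|F G].
  apply/subset_leq_card/subsetP => _ /imsetP[F + ->].
  rewrite /f !inE => /and3P[FK yF FQ]; case: ifPn => xF; last first.
    rewrite cK // setU11 setU1K //.
    by rewrite !inE (negPf xF) andbF.
  rewrite FK xF /=; apply: contraNN FQ => FQ.
  have -> : F :\ y = x |: (F :\ x) :\ y.
    apply/setP => u; rewrite !inE; case: (eqVneq u x) => [->|] //=.
    by rewrite nxy xF.
  by apply: cQ => //; rewrite !inE ?eqxx // eq_sym nxy.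
rewrite /f !inE => /and3P[_ yF _] /and3P[_ yG _].
case: ifPn => xF; case: ifPn => xG // eFG.
- by have := yF; rewrite eFG !inE eqxx eq_sym (negPf nxy).
- by have := yG; rewrite -eFG !inE eqxx eq_sym (negPf nxy).
have/(congr1 (fun A => A :\ x)) := eFG.
rewrite !setU1K ?inE ?(negPf xF) ?(negPf xG) ?andbF // => e1.
by rewrite -(setD1K yF) -(setD1K yG) e1.
Qed.

Lemma sorted_degree e K Q :
  exchange_closed e K -> exchange_closed e Q ->
  sorted (fun x y => val x < val y) e -> sorted geq (map (degree K Q) e).
Proof.
move=> cK cQ; rewrite sorted_map; apply: sub_in_sorted (allss e).
move=> x y xe ye xy.
exact: (degree_decr cK).
Qed.

End DeletionLink.

(** * The spectral recursion for boundary matrices *)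

Section BoundaryMatrix.
Variables (R : numDomainType) (E : {fset int}).
Implicit Types (F G H : {set E}) (K Q : {set {set E}}) (t x y : E).
Implicit Types (e : seq E).

Local Notation S := {set E}.
Local Notation N := #|{: S}|.

(* All boundary matrices are indexed by all subsets of E and padded with zeros,
   which only adds factors 'X to the characteristic polynomials. *)
Definition bd_mx K Q : 'M[R]_N :=
  fun_mx (fun G F : S => ((F \in K) && (G \notin Q))%:R * sgn_face R F G).

(** The map b -> t b on faces avoiding [t], extended by zero; its transpose removes [t]. *)
Definition cone_mx t : 'M[R]_N :=
  fun_mx (fun F G : S => ((t \notin G) && (F == t |: G))%:R).

Lemma mul_cone_mx t (f : S -> S -> R) :
  fun_mx f *m cone_mx t = fun_mx (fun H G => (t \notin G)%:R * f H (t |: G)).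
Proof.
rewrite mul_fun_mx; apply: eq_fun_mx => H G.
rewrite (bigD1 (t |: G)) //= eqxx andbT mulrC big1 ?addr0 // => F /negPf FG.
by rewrite FG andbF mulr0.
Qed.

Lemma cone_mxE t (f : S -> S -> R) :
  cone_mx t *m fun_mx f = fun_mx (fun F G => (t \in F)%:R * f (F :\ t) G).
Proof.
rewrite mul_fun_mx; apply: eq_fun_mx => F G.
rewrite (bigD1 (F :\ t)) //= !inE eqxx /= big1 ?addr0 => [|H HF].
  have -> // : (F == t |: F :\ t) = (t \in F).
  by apply/eqP/idP => [->|tF]; [exact: setU11 | rewrite setD1K].
case: (boolP (t \in H)) => [|tH] /=; first by rewrite mul0r.
by case: (eqVneq F (t |: H)) HF => [->|]; rewrite ?mul0r // setU1K // eqxx.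
Qed.

Lemma tr_cone_mxE t (f : S -> S -> R) :
  (cone_mx t)^T *m fun_mx f =
    fun_mx (fun F G => (t \notin F)%:R * f (t |: F) G).
Proof.
rewrite tr_fun_mx mul_fun_mx; apply: eq_fun_mx => F G.
rewrite (bigD1 (t |: F)) //= eqxx andbT big1 ?addr0 // => H /negPf HF.
by rewrite HF andbF mul0r.
Qed.

Section Step.
Variables (t : E) (e : seq E) (K Q : {set S}).
Hypotheses (te : {in e, forall x, val t < val x}).
Hypotheses (gK : ground (t :: e) K) (cK : exchange_closed (t :: e) K).
Hypotheses (cQ : exchange_closed (t :: e) Q).

Let avoid := fun F : S => t \notin F.
Let M := fun F : S => [&& t \notin F, t |: F \in K & F \notin Q].
Let B := bd_mx K Q.
Let D1 := bd_mx (del t K) (del t Q).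
Let D2 := bd_mx (link t K) (link t Q).
Let C := cone_mx t.
Let P := pred_mx R avoid.
Let PM := pred_mx R M.

Let tK F u : F \in K -> u \in F -> u != t -> val t < val u.
Proof.
by move=> FK uF /negPf ut; have := gK FK uF; rewrite inE ut => /te.
Qed.

Let cone_cone_tr : P + C *m C^T = 1%:M.
Proof.
rewrite /P /pred_mx {2}/C /cone_mx tr_fun_mx cone_mxE add_fun_mx -fun_mx1.
apply: eq_fun_mx => F G; rewrite !inE eqxx /= /avoid.
case: (boolP (t \in F)) => tF /=; last by rewrite mul0r addr0 andbT.
by rewrite andbF setD1K // mul1r add0r eq_sym.
Qed.

Let cone_tr_cone : C^T *m C = P.
Proof.
rewrite {2}/C tr_cone_mxE; apply: eq_fun_mx => F G; rewrite /avoid.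
case: (boolP (t \in F)) => tF /=; rewrite ?andbF ?mul0r // mul1r andbT.
congr (_%:R); case: (boolP (t \in G)) => tG /=.
  by case: eqP => // FG; rewrite FG tG in tF.
congr nat_of_bool; apply/eqP/eqP => [FG|-> //].
by rewrite -(setU1K tF) FG setU1K.
Qed.

Let sgn0 F G : t \notin F -> t \in G -> sgn_face R F G = 0.
Proof.
move=> tF tG; apply: sgn_face_eq0 => v vF e1.
by move: tG; rewrite -e1 !inE (negPf tF) andbF.
Qed.

Let cone_D1 : C^T *m D1 = 0.
Proof.
rewrite tr_cone_mxE -(fun_mx0 _ _ _); apply: eq_fun_mx => G F; rewrite inE.
case: (boolP (t \in F)) => tF; first by rewrite andbF mul0r mulr0.
by rewrite sgn0 ?setU11 // !mulr0.
Qed.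

Let P_D2 : P *m D2 = D2.
Proof.
rewrite mul_pred_mx; apply: eq_fun_mx => G F; rewrite inE /avoid.
case: (boolP (t \in F)) => tF /=; first by rewrite mul0r mulr0.
by case: (boolP (t \in G)) => tG; rewrite ?mul1r // sgn0 // !mulr0.
Qed.

(** Exchange in [K]: if [G] is [F] minus [v] with [F] avoiding [t], replacing [v] by the smaller [t]
    gives [t |: G \in K]. Hence the nonzero rows of [D1] lie in [M]. *)
Let PM_D1 : PM *m D1 = D1.
Proof.
rewrite mul_pred_mx; apply: eq_fun_mx => G F; rewrite !inE.
have [FK|] := boolP (F \in K); last by rewrite /= !mul0r mulr0.
have [tF|tF] := boolP (t \in F); first by rewrite /= !mul0r mulr0.
have [tG|tG] := boolP (t \in G); first by rewrite sgn0 // !mulr0.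
have [GQ|GQ] := boolP (G \in Q); first by rewrite /= !mul0r mulr0.
rewrite /M tG GQ !andbT /=.
have [_|tGK] := boolP (t |: G \in K); first by rewrite mul1r.
rewrite mul0r sgn_face_eq0 ?mulr0 // => v vF FG; case/negP: tGK.
rewrite -FG cK ?inE ?eqxx // (tK FK) //.
by apply: contraNneq tF => <-.
Qed.

(** Exchange in [Q]: if [F \in Q], then [t |: F :\ v \in Q], so every facet of [F] is already
    dropped by the link of [Q]. *)
Let D2_PM : D2 *m PM = D2.
Proof.
rewrite -[D2]trmxK -[PM]tr_pred_mx -trmx_mul; congr (_^T).
rewrite /D2 tr_fun_mx mul_pred_mx; apply: eq_fun_mx => F G; rewrite !inE /M.
have [tF|tF] := boolP (t \in F); first by rewrite /= !mul0r.
have [FK|] := boolP (t |: F \in K); last by rewrite /= !mul0r.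
have [FQ|_] /= := boolP (F \in Q); last by rewrite mul1r.
rewrite mul0r; have [tG|tG] := boolP (t \in G); first by rewrite sgn0 ?mulr0.
have [|GQ] := boolP (t |: G \in Q); first by rewrite /= mul0r.
rewrite sgn_face_eq0 ?mulr0 // => v vF FG; case/negP: GQ.
rewrite -FG cQ ?inE ?eqxx // (tK FK) ?inE ?vF ?orbT //.
by apply: contraNneq tF => <-.
Qed.

Let bd_P : B *m P = D1.
Proof.
rewrite -[B]trmxK -[P]tr_pred_mx -trmx_mul -[RHS]trmxK; congr (_^T).
rewrite !tr_fun_mx mul_pred_mx; apply: eq_fun_mx => F G; rewrite !inE /avoid.
have [tF|tF] := boolP (t \in F); first by rewrite !andbF !mul0r.
have [tG|tG] := boolP (t \in G); first by rewrite sgn0 // !mulr0.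
by rewrite mul1r !andbT.
Qed.

(** Matrix form of the cone formula; rows avoiding [t] give [PM], rows containing [t] give the other
    term. *)
Let bd_cone : B *m C = PM - C *m D2.
Proof.
rewrite mul_cone_mx cone_mxE opp_fun_mx add_fun_mx.
apply: eq_fun_mx => G F; rewrite !inE eqxx /=.
have [tF|tF] := boolP (t \in F); rewrite /M /=.
  rewrite !mul0r mulr0 subr0.
  by case: eqP => //= ->; rewrite tF.
have [FK|FK] := boolP (t |: F \in K); last first.
  rewrite !mul0r mulr0 mulr0 subr0; case: eqP => [->|//].
  by rewrite (negPf FK) andbF.
rewrite sgn_face_setU1 => [|u uF]; last first.
  apply: (tK FK); first by rewrite inE uF orbT.
  by apply: contraNneq tF => <-.
rewrite /= !mul1r.
have [tG|tG] := boolP (t \in G); last first.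
  rewrite !mul0r !subr0 -natrM mulnb.
  case: eqP => [->|_]; last by rewrite andbF.
  by rewrite /= FK andbT.
rewrite setD1K // !mul1r.
have -> /= : (G == F) = false.
  by apply: contraNF tF => /eqP <-.
by rewrite !sub0r mulrN.
Qed.

(** [D1] and [D2] restrict faces differently, so d d = 0 applies only once no intermediate [G] is
    lost: exchange in [K] puts [t |: G] in [K], and [G \in Q] would by exchange in [Q] force
    [H \in link t Q]. *)
Let D2_D1 : D2 *m D1 = 0.
Proof.
rewrite mul_fun_mx -(fun_mx0 _ _ _); apply: eq_fun_mx => H F.
have [FK|FK] := boolP (F \in del t K); last first.
  by rewrite big1 // => G _; rewrite mul0r mulr0.
have [HQ|HQ] := boolP (H \in link t Q).
  by rewrite big1 // => G _; rewrite andbF !mul0r.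
rewrite -[RHS](sgn_face_sgn_face R F H); apply: eq_bigr => G _.
rewrite !andbT andTb mulrC mulrACA -natrM mulnb.
case: (boolP (_ && _)) => [_|GKQ]; first by rewrite mul1r.
rewrite mul0r; apply/esym/eqP; rewrite mulf_eq0; apply: contraNT GKQ.
rewrite negb_or => /andP[/sgn_face_neq0[v vF GE] /sgn_face_neq0[w wG HE]].
move: FK HQ; rewrite !inE => /andP[FK tF] HQ.
have tG : t \notin G by rewrite GE !inE (negPf tF) andbF.
have tH : t \notin H by rewrite HE !inE (negPf tG) andbF.
have ltG u : u \in F -> val t < val u.
  by move=> uF; rewrite (tK FK) //; apply: contraNneq tF => <-.
have -> : t |: G \in K by rewrite GE cK ?inE ?eqxx ?ltG.
rewrite tG !andbT; apply: contra HQ => GQ; rewrite tH HE.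
by rewrite cQ ?inE ?eqxx ?ltG //; move: wG; rewrite GE !inE => /andP[].
Qed.

Let PM_PM : PM *m PM = PM.
Proof.
rewrite {2}/PM mul_pred_mx; apply: eq_fun_mx => F G.
by case: eqP => [->|]; rewrite ?mulr0 //= -natrM mulnb andbb.
Qed.

Let PM_C : PM *m C = 0.
Proof.
rewrite mul_pred_mx -(fun_mx0 _ _ _); apply: eq_fun_mx => F G; rewrite /M.
case: (eqVneq F (t |: G)) => [->|_]; last by rewrite andbF mulr0.
by rewrite setU11 mul0r.
Qed.

Let card_M : #|M| = degree K Q t. Proof. by rewrite degree_link. Qed.

(* [P + C C^T = 1], so B^T B has the same nonzero spectrum as (BJ)^T (BJ) for
   J = (P C), whose blocks are D1 and PM - C D2. *)
Lemma char_poly_step :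
  ('X - 1) ^+ (N + N) * char_poly (B^T *m B) =
  'X^(N - degree K Q t) * ('X - 1) ^+ degree K Q t *
  ((char_poly (D1^T *m D1) * char_poly (D2^T *m D2)) \Po ('X - 1)).
Proof.
have XnN n : ('X : {poly R}) ^+ n != 0 by rewrite expf_neq0 ?polyX_eq0.
pose A := D2^T *m D2 + D1 *m D1^T.
have PM_A : PM *m A = A.
  rewrite mulmxDr !mulmxA PM_D1; congr (_ *m _ + _).
  by rewrite -[PM]tr_pred_mx -trmx_mul D2_PM.
have chiA : 'X^N * char_poly A =
    char_poly (D1^T *m D1) * char_poly (D2^T *m D2).
  rewrite char_poly_add ?mulmxA -?(mulmxA _ D2) ?D2_D1 ?mulmx0 ?mul0mx //.
  rewrite mulrC; congr (_ * _); apply: (mulfI (XnN N)).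
  exact: char_poly_mulmxC.
pose J := row_mx P C.
have JJ : J *m J^T = 1%:M.
  rewrite tr_row_mx mul_row_col tr_pred_mx -cone_cone_tr; congr (_ + _).
  rewrite {2}/P mul_pred_mx; apply: eq_fun_mx => F G.
  by case: eqP => [->|]; rewrite ?mulr0 //= -natrM mulnb andbb.
have BJ : B *m J = row_mx D1 (PM - C *m D2).
  by rewrite mul_mx_row bd_P bd_cone.
(* The shape required by [char_poly_block_gram], with [D1] absorbed by the lower right block since
   [PM *m D1 = D1] and [D2 *m D1 = 0]. *)
have gram : (B *m J)^T *m (B *m J) =
    block_mx (D1^T *m D1) D1^T D1 (PM + D2^T *m D2).
  have PMT : PM^T = PM by rewrite tr_pred_mx.
  have CPM : C^T *m PM = 0 by rewrite -PMT -trmx_mul PM_C trmx0.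
  have e21 : (PM - C *m D2)^T *m D1 = D1.
    by rewrite raddfB /= trmx_mul PMT mulmxBl PM_D1 -mulmxA cone_D1 mulmx0
      subr0.
  rewrite BJ tr_row_mx mul_col_row e21; congr (block_mx _ _ _ _).
    by apply: trmx_inj; rewrite trmx_mul trmxK e21.
  rewrite [(PM - _)^T]raddfB /= trmx_mul PMT mulmxBl !mulmxBr PM_PM mulmxA.
  rewrite PM_C mul0mx.
  rewrite subr0 -(mulmxA _ _ PM) CPM mulmx0 sub0r opprK.
  by rewrite !mulmxA -(mulmxA _ C^T) cone_tr_cone -(mulmxA _ P) P_D2.
(* Moving [J^T] cyclically to the front doubles the size, at the cost of powers of ['X] that
   cancel. *)
have chiB : char_poly (B^T *m B) = char_poly (PM + A).
  apply: (mulfI (XnN (N + N)%N)).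
  have <- : B^T *m (B *m J) *m J^T = B^T *m B.
    by rewrite -!mulmxA JJ mulmx1.
  rewrite -[in LHS](mulmxA _ _ J^T) mulmxA -[in LHS]char_poly_mulmxC.
  rewrite mulmxA -trmx_mul gram char_poly_block_gram ?mulrA -?exprD ?addrA //.
  by rewrite mulmxDl PM_D1 -mulmxA D2_D1 mulmx0 addr0.
(* One factor [('X - 1) ^+ N] serves [char_poly_addl]; the other is ['X^N] of [chiA] after the
   shift. *)
rewrite exprD -mulrA chiB char_poly_addl // mulrCA -card_M.
by rewrite -char_poly_pred_mx -chiA comp_polyM comp_Xn_poly.
Qed.

End Step.

(** Induction on the remaining vertices, smallest first. The exponent [j] only counts zero
    eigenvalues, many of them due to padding. *)
Lemma char_poly_bd_mx e K Q :
  sorted (fun x y => val x < val y) e -> ground e K ->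
  exchange_closed e K -> exchange_closed e Q ->
  exists j, char_poly ((bd_mx K Q)^T *m bd_mx K Q) =
    'X^j * conj_poly R (map (degree K Q) e).
Proof.
have lt_val_trans : transitive (fun x y : E => val x < val y).
  by move=> y x z; apply: lt_trans.
elim: e K Q => [|t e IH] K Q se gK cK cQ.
  (* Without vertices only the empty face can occur, and its boundary is zero. *)
  exists N; rewrite (_ : bd_mx K Q = 0) ?mulmx0; last first.
    rewrite -fun_mx0; apply: eq_fun_mx => G F.
    have [FK|] := boolP (F \in K); last by rewrite mul0r.
    by rewrite sgn_face_eq0 ?mulr0 // => v /(gK F FK).
  by rewrite /char_poly /char_poly_mx map_mx0 subr0 det_scalar mulr1.
have sd := sorted_degree cK cQ se.
have te : {in e, forall x, val t < val x}.
  by move: se; rewrite /= path_sortedE // => /andP[/allP].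
have nte : t \notin e by apply/negP => /te; rewrite ltxx.
have {}se : sorted (fun x y => val x < val y) e.
  by case: (e) se => //= ? ? /andP[].
have [c1 c2] := (exchange_closed_del nte cK, exchange_closed_del nte cQ).
have [c3 c4] := (exchange_closed_link nte cK, exchange_closed_link nte cQ).
have [j1 chi1] := IH _ _ se (ground_del gK) c1 c2.
have [j2 chi2] := IH _ _ se (ground_link gK) c3 c4.
have s1 := sorted_degree c1 c2 se; have s2 := sorted_degree c3 c4 se.
set d1 := degree _ _ in chi1 s1; set d2 := degree _ _ in chi2 s2.
have ed : map (degree K Q) e = [seq (d1 x + d2 x)%N | x <- e].
  apply/eq_in_map => x xe; apply: degree_neq.
  by apply: contraNneq nte => <-.
have chiN j d (A : 'M[R]_N) : sorted geq d ->
    char_poly A = 'X^j * conj_poly R d -> N = (j + head 0%N d)%N.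
  move=> sd' /(congr1 (fun p : {poly R} => size p)).
  rewrite size_char_poly size_mul ?size_polyXn ?size_conj_poly //; first by lia.
    by rewrite -size_poly_gt0 size_polyXn.
  by rewrite -size_poly_gt0 size_conj_poly.
have n1 := chiN _ _ _ s1 chi1; have n2 := chiN _ _ _ s2 chi2.
(* Comparison of degrees in [chi1] and [chi2]; the default head 0 covers empty [e]. *)
have hd : (j1 + j2 + head 0%N (map (degree K Q) e) = N + N)%N.
  by rewrite ed; move: n1 n2; case: (e) => /=; lia.
exists (N - degree K Q t)%N.
rewrite /= in sd *; set h := head 0%N _ in hd *.
have hm : (h <= degree K Q t)%N by rewrite /h; case: (e) sd => //= ? ? /andP[].
have Xn0 : ('X - 1 : {poly R}) ^+ (N + N) != 0.
  by rewrite expf_neq0 // polyXsubC_eq0.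
apply: (mulfI Xn0); rewrite (char_poly_step te gK cK cQ) chi1 chi2.
rewrite mulrACA -exprD -conj_poly_add // -ed !comp_polyM comp_Xn_poly.
rewrite [RHS]mulrCA -!mulrA; congr (_ * _); rewrite !mulrA -!exprD.
(* The exponents of ['X - 1] are [j1 + j2 + m] and [2N + (m - h)] with [m] the degree of [t]; they
   agree by [hd] and [hm]. *)
by congr (_ ^+ _ * _); lia.
Qed.

End BoundaryMatrix.

(** * From shifted pairs to padded matrices *)

Section ShiftedPairs.
Variable E : {fset int}.
Implicit Types (F G H : {set E}) (K Q : {set {set E}}) (t x y : E).

Lemma count_elems F (a : pred int) :
  count a (elems F) = #|[set u in F | a (val u)]|.
Proof.
by rewrite /elems count_sort count_map -sum1_count big_enum_cond sum1dep_card.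
Qed.

(** Sorted sequences are compared through counts: replacing [y] by a smaller [x] cannot lower the
    number of elements below a given bound. *)
Lemma le_P_exchange F x y :
  y \in F -> x \notin F -> val x < val y -> le_P (x |: F :\ y) F.
Proof.
move=> yF xF xy.
have cG : #|x |: F :\ y| = #|F|.
  by rewrite cardsU1 !inE (negPf xF) andbF [RHS](cardsD1 y) yF.
split=> // p; rewrite cG => pF.
have sE G : sorted <=%O (elems G) by exact: sort_le_sorted.
have szE G : size (elems G) = #|G| by rewrite size_sort size_map cardE.
set a := (elems F)`_p.
apply: nth_count_le => //.
have pa : (p < count (<= a)%O (elems F))%N.
  rewrite ltnNge; apply/negP => ca.
  have := @nth_count_gt _ _ a 0 (elems F) p (sE F).
  by rewrite ca szE pF /= -/a ltxx => /(_ isT).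
apply: leq_trans pa _; rewrite !count_elems.
pose f u := if u == y then x else u.
rewrite -(card_in_imset (f := f)) => [|u v].
  apply/subset_leq_card/subsetP => _ /imsetP[u + ->].
  rewrite !inE /f => /andP[uF ua]; case: (eqVneq u y) => [uy|uy].
    by rewrite eqxx /= (le_trans (ltW xy)) // -uy.
  by rewrite uF ua uy orbT.
rewrite !inE /f => /andP[uF _] /andP[vF _].
case: (eqVneq u y) => [->|_]; case: (eqVneq v y) => [->|_] // e.
  by rewrite e vF in xF.
by rewrite -e uF in xF.
Qed.

Lemma exchange_closed_shifted k K e :
  is_family k K -> shifted k K -> exchange_closed e K.
Proof.
move=> fK sK F x y FK _ yF xF xy.
have [cG lG] := le_P_exchange yF xF xy.
by apply: (sK _ F) => //; rewrite ?cG; apply: fK.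
Qed.

(** The degree tests membership only for faces [F :\ x], which lie in [bd K]. *)
Lemma same_pair_degree K Q Q' x :
  same_pair K Q Q' -> degree K Q x = degree K Q' x.
Proof.
move=> QQ; apply: eq_card => F; rewrite !inE.
have [FK|//] := boolP (F \in K); have [xF|//] := boolP (x \in F).
have FxK : F :\ x \in bd K by apply/imset2P; exists F x; rewrite ?inE.
by have /setP/(_ (F :\ x)) := QQ; rewrite !inE FxK /= => ->.
Qed.

(** The Laplacian is the Gram matrix of [B] with its columns restricted to [K]; the powers of ['X]
    account for the padding. *)
Lemma char_poly_laplacian (R : realType) K Q Q' : same_pair K Q Q' ->
  'X^#|{: {set E}}| * char_poly (laplacian R K Q) =
  'X^#|K| * char_poly ((bd_mx R K Q')^T *m bd_mx R K Q').
Proof.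
move=> QQ; set B := bd_mx R K Q'.
pose I : 'M[R]_(#|K|, #|{: {set E}}|) :=
  \matrix_(i, j) (enum_val i == enum_val j)%:R.
have ITI : I^T *m I = pred_mx R (fun F => F \in K).
  apply/matrixP => i j; rewrite !mxE /=.
  transitivity (\sum_(F in K)
     (F == enum_val i)%:R * (F == enum_val j)%:R : R).
    by rewrite [RHS]big_enum_val; apply: eq_bigr => l _; rewrite !mxE.
  have [iK|iK] := boolP (enum_val i \in K); last first.
    rewrite andbF big1 // => F FK; case: eqP => [e|]; last by rewrite mul0r.
    by rewrite -e FK in iK.
  rewrite (bigD1 (enum_val i)) //= eqxx mul1r andbT big1 ?addr0 // => F.
  by move=> /andP[_ /negPf ->]; rewrite mul0r.
have BK : B *m pred_mx R (fun F => F \in K) = B.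
  rewrite -[B]trmxK -[pred_mx _ _]tr_pred_mx -trmx_mul; congr (_^T).
  rewrite tr_fun_mx mul_pred_mx; apply: eq_fun_mx => F G /=.
  by case: (F \in K); rewrite ?mul1r // !mul0r.
have BI i j : (B *m I^T) i j =
    (enum_val i \notin Q')%:R * sgn_face R (enum_val j) (enum_val i).
  rewrite mxE; under eq_bigr do rewrite !mxE.
  rewrite -(big_enum_val (fun F => ((F \in K) && (enum_val i \notin Q'))%:R *
    sgn_face R F (enum_val i) * (enum_val j == F)%:R)) /=.
  rewrite (bigD1 (enum_val j)) //= eqxx mulr1 enum_valP big1 ?addr0 // => F.
  by rewrite eq_sym => /negPf ->; rewrite mulr0.
have -> : laplacian R K Q = (B *m I^T)^T *m (B *m I^T).
  apply/matrixP => i j; rewrite mxE [RHS]mxE.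
  under eq_bigr do rewrite !mxE.
  under [RHS]eq_bigr do rewrite mxE !BI.
  rewrite -(big_enum_val (fun G => sgn_face R (enum_val i) G *
    sgn_face R (enum_val j) G)).
  rewrite -(big_enum_val (fun G =>
    (G \notin Q')%:R * sgn_face R (enum_val i) G *
    ((G \notin Q')%:R * sgn_face R (enum_val j) G))) /= big_mkcond.
  (* Outside [bd K] the incidence numbers vanish; inside it the two second families agree. *)
  apply: eq_bigr => G _; rewrite inE.
  have [GK|GK] := boolP (G \in bd K); last first.
    rewrite andbF sgn_face_eq0 ?mulr0 ?mul0r // => v vF e; case/negP: GK.
    by apply/imset2P; exists (enum_val i) v; rewrite ?inE ?vF ?enum_valP.
  have /setP/(_ G) := QQ; rewrite !inE GK /= andbT => ->.
  by case: (G \in Q'); rewrite /= ?mul0r ?mul1r.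
rewrite char_poly_mulmxC trmx_mul trmxK -mulmxA (mulmxA I^T) ITI mulmxA BK.
congr (_ * _); apply: (@mulfI _ 'X^#|{: {set E}}|).
  by rewrite expf_neq0 ?polyX_eq0.
exact: char_poly_mulmxC.
Qed.

End ShiftedPairs.

(** * Reading off the nonzero eigenvalues *)

(** If [j < i], cancelling ['X^j] would make ['X] divide [q], against [q.[0] != 0]. *)
Lemma mulXn_inj_horner0 (R : idomainType) (p q : {poly R}) i j :
  q.[0] != 0 -> 'X^i * p = 'X^j * q -> exists l, p = 'X^l * q.
Proof.
have X0 n : ('X : {poly R}) ^+ n != 0 by rewrite expf_neq0 ?polyX_eq0.
move=> q0 e; have [ij|ji] := leqP i j.
  exists (j - i)%N; apply: (mulfI (X0 i)).
  by rewrite e mulrA -exprD subnKC.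
case/negP: q0; move: e; rewrite -(subnKC ji) addSnnS exprD -mulrA.
move=> /(mulfI (X0 j)) <-.
by rewrite hornerM hornerXn expr0n mul0r.
Qed.

Lemma conj_part_neq0 d : 0%N \notin conj_part d.
Proof.
apply/negP => /mapP[i]; rewrite mem_iota add1n ltnS => /andP[i0 im].
move=> /esym/eqP; rewrite -leqn0 leqNgt -has_count => /hasPn no.
suff : (\max_(x <- d) x <= i.-1)%N by lia.
by apply/bigmax_leqP_seq => x /no; rewrite -ltnNge; lia.
Qed.

Theorem theorem5p7 (R : realType) (E : {fset int}) (k : nat)
    (K K' : {set {set E}}) :
  (0 < k)%N -> is_family k K -> is_family k.-1 K' -> shifted_pair k K K' ->
  exists2 s : seq R,
    is_spectrum (laplacian R K K') s &
    eq_nonzero s [seq m%:R | m <- conj_part (degree_seq K K')].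
Proof.
move=> _ fK _ [sK [K'' [fK'' QQ sK'']]].
pose e : seq E := sort (fun x y => val x <= val y) (enum {: E}).
have se : sorted (fun x y => val x < val y) e.
  suff: sorted <%O [seq val x | x <- e] by rewrite sorted_map.
  rewrite lt_sorted_uniq_le sorted_map.
  rewrite (map_inj_uniq val_inj) sort_uniq enum_uniq.
  by apply: sort_sorted => x y; apply: le_total.
have gK : ground e K by move=> F _ x _; rewrite mem_sort mem_enum.
have cK : exchange_closed e K := exchange_closed_shifted fK sK.
have cK'' : exchange_closed e K'' := exchange_closed_shifted fK'' sK''.
have [j chi] := char_poly_bd_mx R se gK cK cK''.
have sd := sorted_degree cK cK'' se.
(* Degrees already decrease along the increasing vertex order, so sorting them changes nothing. *)
have ed : degree_seq K K' = map (degree K K'') e.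
  apply: (sorted_eq (leT := geq)) => //.
  - by move=> y x z xy yz; apply: leq_trans yz xy.
  - by move=> x y; rewrite andbC; apply: anti_leq.
  - by apply: sort_sorted => x y; apply: leq_total.
  rewrite /degree_seq perm_sort /image_mem.
  rewrite (eq_map (fun x => same_pair_degree x QQ)).
  by apply: perm_map; rewrite perm_sym perm_sort.
have := char_poly_laplacian R QQ.
rewrite chi -prod_conj_part // -ed mulrA -exprD.
set c := conj_part _ => /mulXn_inj_horner0[|l chiL].
  rewrite horner_prod prodf_seq_neq0; apply/allP => m mc /=.
  rewrite hornerXsubC sub0r oppr_eq0 pnatr_eq0.
  by apply: contraTneq mc => ->; apply: conj_part_neq0.
(* The leftover factor ['X^l] contributes exactly [l] zero eigenvalues. *)
pose s : seq R := nseq l 0 ++ [seq m%:R | m <- c].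
exists (sort >=%R s); last first.
  move=> x x0; rewrite count_sort count_cat count_nseq /=.
  by rewrite eq_sym (negPf x0) mul0n.
split; first by apply: sort_sorted; apply: ge_total.
rewrite chiL (perm_big s) /=; last by rewrite perm_sort.
rewrite big_cat [in RHS]big_map; congr (_ * _).
by rewrite big_nseq subr0 iter_mulr_1.
Qed.
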